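(* Let $G$ be a graph and $S$ a set of pairs of non-adjacent vertices of $G$, each at distance at most $2$ in $G$. Then the number of colorings $c:E(G)\to\{1,2\}$ such that every pair $\{u,v\}\in S$ is connected by a rainbow path equals \[\sum_{X\subseteq S}(-1)^{|X|}\,2^{|E(G)/\approx_X|}.\]
   Context: A path is rainbow if its edges have pairwise different colors. For $X\subseteq S$, let $\mathcal P_X$ be the set of all paths with exactly two edges whose endpoints form a pair in $X$. Two edges $e_1,e_2\in E(G)$ are linked by $X$, written $e_1\sim_X e_2$, if there are paths $P_1,P_2\in\mathcal P_X$ (possibly $P_1=P_2$) with $e_1\in E(P_1)$, $e_2\in E(P_2)$ and $E(P_1)\cap E(P_2)\neq\emptyset$. Let $\approx_X$ be the transitive closure of $\sim_X$ (an equivalence relation on $E(G)$, where edges on no path of $\mathcal P_X$ form singleton classes), and $E(G)/\approx_X$ its set of equivalence classes. *)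

(* Defs.v *)
From HB Require Import structures.
From mathcomp Require Import all_boot all_order all_algebra.
Set Implicit Arguments.
Unset Strict Implicit.
Unset Printing Implicit Defensive.

Record sgraph := SGraph {
  vertex :> finType;
  adj : rel vertex;
  adj_sym : symmetric adj;
  adj_irrefl : irreflexive adj }.

Definition edge_set (G : sgraph) : {set {set G}} :=
  [set f : {set G} | [exists x, exists y, adj x y && (f == [set x; y])]].

Definition edge (G : sgraph) : finType :=
  {f : {set G} | f \in edge_set G}.

(* A path is its first vertex together with the sequence of the later ones.
   The bound on the length of that sequence is harmless, as the vertices of a
   path are distinct; it makes the type of paths finite. *)
Definition is_path (G : sgraph) (P : G * #|G|.-bseq G) : bool :=
  path (@adj G) P.1 P.2 && uniq (P.1 :: P.2).

Definition gpath (G : sgraph) : finType :=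
  {P : G * #|G|.-bseq G | is_path P}.

Definition source (G : sgraph) (P : gpath G) : G := (sval P).1.

Definition target (G : sgraph) (P : gpath G) : G :=
  last (sval P).1 (sval P).2.

Definition path_length (G : sgraph) (P : gpath G) : nat := size (sval P).2.

Definition path_edges (G : sgraph) (P : gpath G) : {set edge G} :=
  [set f : edge G |
    sval f \in pairmap (fun x y => [set x; y]) (sval P).1 (sval P).2].

Definition endpoints (G : sgraph) (P : gpath G) : {set G} :=
  [set source P; target P].

(* In particular, no [d] satisfies this when [u] and [v] lie in different
   components. *)
Definition has_distance (G : sgraph) (u v : G) (d : nat) : Prop :=
  (exists P : gpath G, [/\ source P = u, target P = v & path_length P = d]) /\
  (forall P : gpath G, source P = u -> target P = v -> d <= path_length P).

Definition coloring (G : sgraph) : finType := {ffun edge G -> 'I_2}.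

Definition rainbow (G : sgraph) (c : coloring G) (P : gpath G) : bool :=
  [forall e in path_edges P, forall f in path_edges P,
    (e != f) ==> (c e != c f)].

Definition rainbow_connected (G : sgraph) (c : coloring G) (p : {set G}) :
    bool :=
  [exists P : gpath G, (endpoints P == p) && rainbow c P].

Definition two_paths (G : sgraph) (X : {set {set G}}) : {set gpath G} :=
  [set P : gpath G | (path_length P == 2) && (endpoints P \in X)].

Definition linked (G : sgraph) (X : {set {set G}}) : rel (edge G) :=
  fun e1 e2 =>
    [exists P1 in two_paths X, exists P2 in two_paths X,
      [&& e1 \in path_edges P1, e2 \in path_edges P2
        & path_edges P1 :&: path_edges P2 != set0]].

(* [connect] is the reflexive transitive closure; reflexivity is what turns the
   edges lying on no path of [two_paths X] into singleton classes. *)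
Definition link_classes (G : sgraph) (X : {set {set G}}) :
    {set {set edge G}} :=
  equivalence_partition (connect (linked X)) [set: edge G].

(* Main.v *)
(** A pair of distinct non-adjacent vertices is joined by a rainbow path in two
    colours exactly when it is joined by a two-edge path that is not
    monochromatic, as three distinct edges cannot receive three colours.  So a
    colouring fails at every pair of [X] if and only if all paths in
    [two_paths X] are monochromatic, that is, if and only if it is constant on
    the classes of [linked X].  There are [2 ^ #|link_classes X|] such
    colourings, and inclusion-exclusion over [X] concludes. *)
Require Import Defs.
From HB Require Import structures.
From mathcomp Require Import all_boot all_order all_algebra.
Set Implicit Arguments.
Unset Strict Implicit.
Unset Printing Implicit Defensive.

(** Such functions are exactly those that factor through the quotient map [cls], and they factor
    uniquely because [cls] is onto. Hence composition with [cls] is a bijection from the functions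
    on the blocks. *)
Lemma card_class_functions (T U : finType) (e : rel T) :
  {in [set: T] & &, equivalence_rel e} ->
  #|[set f : {ffun T -> U} | [forall x, forall y, e x y ==> (f x == f y)]]|
    = #|U| ^ #|equivalence_partition e [set: T]|.
Proof.
move=> eqe; set P := equivalence_partition e [set: T].
have partP : partition P [set: T] by apply: equivalence_partitionP.
have coverP x : x \in cover P by rewrite (cover_partition partP).
have trivP := partition_trivIset partP.
pose W : finType := {B : {set T} | B \in P}.
pose cls x : W := exist _ (pblock P x) (pblock_mem (coverP x)).
(* A block of a partition is nonempty, so a representative can be chosen; [rep] is then a section of
   [cls]. *)
have repW (B : W) : exists x, x \in sval B.
  apply/set0Pn; have := valP B; apply: contraTneq => /= ->.
  by rewrite (partition0 partP).
pose rep B := xchoose (repW B).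
have repK B : cls (rep B) = B.
  apply: val_inj; apply: (def_pblock trivP (valP B)).
  exact: xchooseP (repW B).
have clsE x y : (cls x == cls y) = e x y.
  rewrite -val_eqE /= eq_pblock ?coverP //.
  by rewrite pblock_equivalence_partition // ?inE.
pose h (g : {ffun W -> U}) : {ffun T -> U} := [ffun x => g (cls x)].
have h_inj : injective h.
  move=> g1 g2 /ffunP eqg; apply/ffunP => B.
  by have := eqg (rep B); rewrite !ffunE repK.
have -> : #|P| = #|W| by rewrite card_sig.
rewrite -card_ffun -(card_imset predT h_inj).
apply: eq_card => f; rewrite inE; apply/idP/imsetP => [/forallP cf | [g _ ->]].
  exists [ffun B => f (rep B)] => //; apply/ffunP => x; rewrite !ffunE.
  have /forallP/(_ (rep (cls x)))/implyP := cf x.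
  by rewrite -clsE repK => /(_ (eqxx _))/eqP.
apply/forallP => x; apply/forallP => y; apply/implyP.
by rewrite -clsE !ffunE => /eqP ->.
Qed.

Section InclusionExclusion.

Import GRing.Theory.
Local Open Scope ring_scope.

(** Expand the product over all [i] of [(if i \in B then -1 else 0) + 1]. Any element of [B]
    contributes a factor [-1 + 1 = 0], and in the expansion only the sets inside [B] survive. *)
Lemma sum_sign_subset (T : finType) (B : {set T}) :
  \sum_(X : {set T} | X \subset B) (-1) ^+ #|X| = (B == set0)%:R :> int.
Proof.
have := @bigA_distr int 0 1 *%R +%R T
  (fun i => if i \in B then -1 else 0) (fun=> 1).
rewrite (bigID (mem B)) /= [X in _ * X]big1; last first.
  by move=> i /negbTE ->; rewrite add0r.
rewrite mulr1 [LHS](_ : _ = (B == set0)%:R); last first.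
  have [->|/set0Pn[i iB]] := eqVneq B set0.
    by rewrite big1 // => i; rewrite inE.
  by rewrite (bigD1 i) //= iB addNr mul0r.
move=> ->; rewrite [RHS](bigID (fun X : {set T} => X \subset B)) /=.
rewrite [X in _ + X]big1 ?addr0 => [|X /subsetPn[i iX iB]]; last first.
  by rewrite (bigD1 i) //= iX (negbTE iB) mul0r.
apply: eq_bigr => X sXB; rewrite -big_mkcond -prodr_const /=.
by apply: eq_bigr => i iX; rewrite (subsetP sXB).
Qed.

(** Exchange the two summations: for a fixed [c], the sets [X] that count are the subsets of the set
    of failures of [c] in [S], and their signs add up to 1 if there is no failure and to 0
    otherwise. *)
Lemma inclusion_exclusion (T C : finType) (S : {set T}) (good : C -> pred T) :
  #|[set c | [forall p in S, good c p]]|%:Z =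
  \sum_(X : {set T} | X \subset S)
    (-1) ^+ #|X| * #|[set c | [forall p in X, ~~ good c p]]|%:Z.
Proof.
transitivity (\sum_c \sum_(X : {set T} | (X \subset S)
    && [forall p in X, ~~ good c p]) ((-1) ^+ #|X| : int)).
  rewrite -sum1_card -natz natr_sum big_mkcond /=; apply: eq_bigr => c _.
  rewrite (eq_bigl (fun X : {set T} =>
      X \subset [set p in S | ~~ good c p])) => [|X]; last first.
    rewrite setIdE subsetI; congr andb.
    by apply/forall_inP/subsetP => H p /H; rewrite inE.
  rewrite sum_sign_subset inE; case: forall_inP => H.
    suff -> : [set p in S | ~~ good c p] = set0 by rewrite eqxx.
    by apply/setP => p; rewrite !inE; apply/negP => /andP[/H ->].
  case: eqP => // E; case: H => p pS.
  by move/setP/(_ p): E; rewrite !inE pS => /negbFE.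
rewrite (exchange_big_dep (fun X : {set T} => X \subset S)) /=; last first.
  by move=> c X _ /andP[].
apply: eq_bigr => X sXS; rewrite sXS sumr_const -mulr_natr natz.
by congr (_ * Posz _); apply: eq_card => c; rewrite !inE.
Qed.

End InclusionExclusion.

Lemma adj_edge (G : sgraph) (x y : G) :
  adj x y -> exists e : edge G, sval e = [set x; y].
Proof.
move=> xy; have He : [set x; y] \in edge_set G.
  by rewrite inE; apply/existsP; exists x; apply/existsP; exists y; rewrite xy /=.
by exists (exist (fun f => f \in edge_set G) _ He).
Qed.

Lemma set2_neq (T : finType) (x y z t : T) :
  x != z -> x != t -> [set x; y] != [set z; t].
Proof.
move=> xz xt; apply/eqP => /setP/(_ x).
by rewrite !inE eqxx (negbTE xz) (negbTE xt).
Qed.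

(** Length 0 contradicts [u != v] and length 1 contradicts [~~ adj u v]. A path of length at least 3
    begins with three edges, distinct because its vertices are, and two colours do not suffice for
    them. *)
Lemma rainbow_path_length2 (G : sgraph) (c : coloring G) (P : gpath G)
    (u v : G) :
  endpoints P = [set u; v] -> u != v -> ~~ adj u v -> rainbow c P ->
  path_length P = 2.
Proof.
move=> endP uv nuv /forall_inP rP.
have uP : u \in endpoints P by rewrite endP set21.
have vP : v \in endpoints P by rewrite endP set22.
have dist a b : a \in path_edges P -> b \in path_edges P ->
    sval a != sval b -> c a != c b.
  by move=> aP bP ab; have /forall_inP/(_ b bP)/implyP := rP a aP; apply.
move: uP vP dist {endP rP}; rewrite /endpoints /source /target /path_length.
case: P => -[x [[|y [|z [|t s]]] sz]] //= pP.
- by rewrite setUid !inE => /eqP ux /eqP vx; rewrite ux vx eqxx in uv.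
- have xy : adj x y by move: pP; rewrite /is_path /= andbT => /andP[].
  move=> + + _; rewrite !inE.
  by case/orP=> /eqP eu; case/orP=> /eqP ev; move: uv nuv;
    rewrite eu ev ?eqxx ?xy // adj_sym xy.
move=> _ _ dist; move: (pP); rewrite /is_path /= !inE !negb_or.
case/andP=> /and4P[xy yz zt _] /andP[/and4P[nxy nxz nxt _] /andP[]].
case/and3P=> nyz nyt _ _.
have [a Ea] := adj_edge xy; have [b Eb] := adj_edge yz.
have [d Ed] := adj_edge zt.
have := dist a b; have := dist b d; have := dist a d.
rewrite !inE Ea Eb Ed !eqxx /= !orbT !set2_neq // => /(_ isT isT isT) ad.
move=> /(_ isT isT isT) bd /(_ isT isT isT) ab.
(* Pigeonhole by enumeration: among three values in ['I_2] two coincide. *)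
by case: (c a) (c b) (c d) ab bd ad => [[|[|i]] Hi] [[|[|j]] Hj] [[|[|k]] Hk].
Qed.

Lemma two_path_edges (G : sgraph) (P : gpath G) :
  path_length P = 2 ->
  exists a b : edge G, a != b /\ path_edges P = [set a; b].
Proof.
rewrite /path_length /path_edges.
case: P => -[x [[|y [|z [|t s]]] sz]] //= pP _.
move: (pP); rewrite /is_path /= !inE !negb_or.
case/andP=> /and3P[xy yz _] /and3P[/andP[nxy nxz] nyz _].
have [a Ea] := adj_edge xy; have [b Eb] := adj_edge yz.
exists a, b; split; first by rewrite -val_eqE /= Ea Eb set2_neq.
by apply/setP => e; rewrite !inE -!val_eqE /= Ea Eb.
Qed.

Lemma rainbow_two_edges (G : sgraph) (c : coloring G) (P : gpath G)
    (a b : edge G) :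
  a != b -> path_edges P = [set a; b] -> rainbow c P = (c a != c b).
Proof.
move=> ab EP; rewrite /rainbow EP; apply/forall_inP/idP => [H | cab e].
  by have /forall_inP/(_ b (set22 _ _)) := H a (set21 _ _); rewrite ab.
have cba : c b != c a by rewrite eq_sym.
rewrite !inE => He; apply/forall_inP => f; rewrite !inE => Hf.
by case/orP: He => /eqP->; case/orP: Hf => /eqP->;
  rewrite ?eqxx ?cab ?cba ?implybT.
Qed.

(** Exchanging the two paths suffices; this is what makes [connect (linked X)] an equivalence
    relation. *)
Lemma linked_sym (G : sgraph) (X : {set {set G}}) : symmetric (linked X).
Proof.
suff H x y : linked X x y -> linked X y x by move=> x y; apply/idP/idP; apply: H.
case/exists_inP=> P PX /exists_inP[Q QX /and3P[xP yQ PQ]].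
apply/exists_inP; exists Q => //; apply/exists_inP; exists P => //.
by rewrite yQ xP setIC PQ.
Qed.

Lemma unconnected_class_constant (G : sgraph) (X : {set {set G}})
    (hX : forall p, p \in X ->
       exists u v : G, [/\ p = [set u; v], u != v & ~~ adj u v])
    (c : coloring G) :
  [forall p in X, ~~ rainbow_connected c p] =
  [forall e, forall f, connect (linked X) e f ==> (c e == c f)].
Proof.
apply/forall_inP/idP => [unconn | /forallP cc p pX]; last first.
  apply/existsP => -[P /andP[/eqP endP rP]].
  have [u [v [Ep uv nuv]]] := hX p pX.
  have lP : path_length P = 2.
    by apply: rainbow_path_length2 uv nuv rP; rewrite endP Ep.
  have [a [b [ab EP]]] := two_path_edges lP.
  have PX : P \in two_paths X by rewrite inE lP endP pX.
  (* The path [P] serves as both witnesses, so its own two edges are linked. *)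
  have ab_linked : linked X a b.
    apply/exists_inP; exists P => //; apply/exists_inP; exists P => //.
    by rewrite EP set21 set22 setIid; apply/set0Pn; exists a; rewrite set21.
  have /forallP/(_ b)/implyP/(_ (connect1 ab_linked)) := cc a.
  by move: rP; rewrite (rainbow_two_edges c ab EP) => /negbTE ->.
have mono P : P \in two_paths X -> {in path_edges P &, forall e f, c e = c f}.
  rewrite inE => /andP[/eqP lP endP].
  have [a [b [ab EP]]] := two_path_edges lP.
  have cab : c a = c b.
    apply/eqP/negPn; rewrite -(rainbow_two_edges c ab EP).
    apply: contra (unconn _ endP) => rP.
    by apply/existsP; exists P; rewrite eqxx.
  by move=> e f; rewrite EP !inE => /orP[]/eqP-> /orP[]/eqP->.
(* An edge [g] common to the two monochromatic paths carries the colour from one to the other. *)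
have linkC e f : linked X e f -> c e = c f.
  case/exists_inP=> P PX /exists_inP[Q QX /and3P[eP fQ /set0Pn[g]]].
  by rewrite inE => /andP[gP gQ]; rewrite (mono P PX e g) // (mono Q QX g f).
apply/forallP => e; apply/forallP => f; apply/implyP => /connectP[s + ->].
by elim: s e => [|g s IH] e //= /andP[/linkC -> /IH].
Qed.

Theorem theorem4 (G : sgraph) (S : {set {set G}})
    (hS : forall p : {set G}, p \in S ->
       exists u v : G,
         [/\ p = [set u; v], u != v, ~~ adj u v
           & exists2 d : nat, has_distance u v d & d <= 2]) :
  ((#|[set c : coloring G | [forall p in S, rainbow_connected c p]]|%:Z)%R =
   \sum_(X : {set {set G}} | X \subset S)
      (-1) ^+ #|X| * 2 ^+ #|link_classes X| :> int)%R.
Proof.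
rewrite inclusion_exclusion; apply: eq_bigr => X sXS; congr (_ * _)%R.
have hX p : p \in X ->
    exists u v : G, [/\ p = [set u; v], u != v & ~~ adj u v].
  by move=> /(subsetP sXS)/hS[u [v [? ? ? _]]]; exists u, v.
have eqL : {in [set: edge G] & &, equivalence_rel (connect (linked X))}.
  move=> x y z _ _ _; split=> [|xy]; first exact: connect0.
  exact: (same_connect (sym_connect_sym (@linked_sym G X)) xy).
under eq_finset => c do rewrite unconnected_class_constant //.
(* The base 2 is the number of colours, [#|'I_2|]. *)
by rewrite card_class_functions // card_ord -natz GRing.natrX.
Qed.
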